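(* Given a set $F$ with $n$ elements together with binary operations $\oplus,\odot:F\times F\to F$ given by their Cayley tables, there is a deterministic algorithm that decides in time $O(n^2)$ whether $(F,\oplus,\odot)$ is a field.
   Context: Computation is in the word-RAM model with $O(\log n)$-bit words; the input consists of the $n\times n$ Cayley tables. *)

(* Defs.v *)
From mathcomp Require Import all_boot.

Set Implicit Arguments.
Unset Strict Implicit.
Unset Printing Implicit Defensive.

(** * The word-RAM *)

(** A program is a fixed finite list of instructions, independent of the input
    and of the word size.  Registers and memory cells are indexed by [nat]; a
    program names finitely many registers, and a computed address is the value
    of a register, hence below [2 ^ w] on a machine with [w]-bit words. *)

Inductive binop :=
  WAdd | WSub | WMul | WDiv | WMod | WAnd | WOr | WXor | WShl | WShr.

Inductive comparison := WEq | WLt.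

Inductive instr :=
| Const (d v : nat)                            (* R[d] <- v *)
| Op (o : binop) (d a b : nat)                 (* R[d] <- R[a] o R[b] *)
| Read (d a : nat)                             (* R[d] <- M[R[a]] *)
| Write (a s : nat)                            (* M[R[a]] <- R[s] *)
| Jump (l : nat)                               (* goto l *)
| JumpIf (c : comparison) (a b : nat) (l : nat) (* if R[a] c R[b] goto l *)
| Halt (a : nat).                              (* stop with output R[a] *)

Definition program := seq instr.

Record config := Config { pc : nat; regs : nat -> nat; mem : nat -> nat }.

Definition update (f : nat -> nat) (i v : nat) : nat -> nat :=
  fun j => if j == i then v else f j.

(** Results are reduced modulo [2 ^ w] when they are written by [exec]; thus
    [WSub] is subtraction with wraparound.  Division by zero follows [divn] and
    [modn]: the quotient is [0] and the remainder is the dividend. *)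
Definition eval_op (w : nat) (o : binop) (x y : nat) : nat :=
  match o with
  | WAdd => x + y
  | WSub => x + 2 ^ w - y
  | WMul => x * y
  | WDiv => x %/ y
  | WMod => x %% y
  | WAnd => Nat.land x y
  | WOr => Nat.lor x y
  | WXor => Nat.lxor x y
  | WShl => x * 2 ^ y
  | WShr => x %/ 2 ^ y
  end.

Definition eval_cmp (c : comparison) (x y : nat) : bool :=
  match c with WEq => x == y | WLt => x < y end.

Definition set_reg (w : nat) (c : config) (d v : nat) : config :=
  Config (pc c).+1 (update (regs c) d (v %% 2 ^ w)) (mem c).

Definition exec (w : nat) (i : instr) (c : config) : config :=
  let R := regs c in
  match i with
  | Const d v => set_reg w c d v
  | Op o d a b => set_reg w c d (eval_op w o (R a) (R b))
  | Read d a => set_reg w c d (mem c (R a))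
  | Write a s => Config (pc c).+1 R (update (mem c) (R a) (R s %% 2 ^ w))
  | Jump l => Config l R (mem c)
  | JumpIf t a b l =>
      Config (if eval_cmp t (R a) (R b) then l else (pc c).+1) R (mem c)
  | Halt _ => c
  end.

(** [run w P t c = Some v] iff [P], started in [c], executes [Halt] with output
    [v] after at most [t] instructions, each of unit cost ([Halt] included).
    A jump outside the program does not count as halting. *)
Fixpoint run (w : nat) (P : program) (t : nat) (c : config) : option nat :=
  if t is t'.+1 then
    match onth P (pc c) with
    | Some (Halt a) => Some (regs c a)
    | Some i => run w P t' (exec w i c)
    | None => None
    end
  else None.

(** [k] times the bit length of [n], [k] being a constant of the machine. *)
Definition word_size (k n : nat) : nat := k * (trunc_log 2 n).+1.

Definition big_O (f g : nat -> nat) : Prop :=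
  exists C N, forall n, N <= n -> f n <= C * g n.

(** * Input *)

(** The row-major Cayley table; [x] is named by its rank, which is in
    [{0, ..., #|F| - 1}].  As the enumeration of a [finType] is arbitrary, so is
    this naming. *)
Definition cayley (F : finType) (op : F -> F -> F) : seq nat :=
  [seq nat_of_ord (enum_rank (op x y)) | x <- enum F, y <- enum F].

(** [R[0] = n]; the [2 n^2] table entries start at address [0], addition first;
    everything else is [0]. *)
Definition init (F : finType) (add mul : F -> F -> F) : config :=
  Config 0 (update (fun=> 0) 0 #|F|) (nth 0 (cayley add ++ cayley mul)).

(** * Fields *)

Record field_axioms (F : Type) (add mul : F -> F -> F) (zero one : F) : Prop :=
  FieldAxioms {
    field_addA : associative add;
    field_addC : commutative add;
    field_add0 : left_id zero add;
    field_addN : forall x, exists y, add y x = zero;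
    field_mulA : associative mul;
    field_mulC : commutative mul;
    field_mul1 : left_id one mul;
    field_mulV : forall x, x <> zero -> exists y, mul y x = one;
    field_mulD : left_distributive mul add;
    field_one_neq0 : one <> zero
  }.

Definition is_field (F : Type) (add mul : F -> F -> F) : Prop :=
  exists zero one, field_axioms add mul zero one.

(** On the given input, [P] halts within [t] steps with output [1] if the
    structure is a field and output [0] otherwise. *)
Definition decides_field (w : nat) (P : program) (t : nat)
    (F : finType) (add mul : F -> F -> F) : Prop :=
  exists b : bool,
    run w P t (init add mul) = Some (nat_of_bool b) /\
    (b <-> is_field add mul).

(* Main.v *)
(** If [z] is the zero, [e] the one and [g] generates the multiplicative group,
    every nonzero element is a power of [g].  Hence identities that are
    equivariant under left multiplication need only be tested for [g] or [e]:
    [g (x y) = (g x) y] and [g (x + y) = g x + g y] spread to all powers of [g]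
    by induction, and multiplying [e + (x + y) = (e + x) + y] by a power of [g]
    yields associativity of the addition.  Each test is over pairs.
    The generator is found in quadratic time too: for each candidate, the first
    [i] with [g ^ i.+1 = e] is found in linear time and compared with [n - 2].
    In the presence of the other tests this order condition forces the powers of
    [g] to be distinct and nonzero, hence to exhaust the nonzero elements; in a
    field such a [g] exists because the multiplicative group is cyclic. *)

Require Import Defs.
From HB Require Import structures.
From mathcomp Require Import all_boot ssralg poly finalg cyclic finfield.
From mathcomp Require Import zify ring.

Set Implicit Arguments.
Unset Strict Implicit.
Unset Printing Implicit Defensive.

(** * Timed execution and placement of code *)

Section Execution.

Variables (w : nat) (P : program).

(** Quantifying over the remaining fuel [s] lets runs compose by adding their lengths, with no
    reference to halting. *)
Definition steps (t : nat) (c c' : config) : Prop :=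
  forall s, run w P (t + s) c = run w P s c'.

Lemma steps_trans t1 t2 c1 c2 c3 :
  steps t1 c1 c2 -> steps t2 c2 c3 -> steps (t1 + t2) c1 c3.
Proof. by move=> h1 h2 s; rewrite -addnA h1 h2. Qed.

Lemma steps1 i c :
  onth P (pc c) = Some i -> (if i is Halt _ then False else True) ->
  steps 1 c (exec w i c).
Proof.
move=> Pi Ni s; rewrite add1n /= Pi.
by case: i Pi Ni.
Qed.

Fixpoint code_at (p : nat) (s : seq instr) : Prop :=
  if s is i :: s' then onth P p = Some i /\ code_at p.+1 s' else True.

Lemma code_at_cat p s1 s2 :
  code_at p (s1 ++ s2) -> code_at p s1 /\ code_at (p + size s1) s2.
Proof.
elim: s1 p => [|i s1 IH] p /=; first by rewrite addn0.
by case=> -> /IH; rewrite addSnnS => -[].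
Qed.

End Execution.

Arguments steps1 w {P i} c Pi.

Lemma code_at_self P : code_at P 0 P.
Proof.
suff H s A : code_at (A ++ s) (size A) s by apply: (H P [::]).
elim: s A => //= i s IH A; split; last first.
  by have := IH (rcons A i); rewrite cat_rcons size_rcons.
by elim: A.
Qed.

(** * A small formula language and its compilation to jumping code *)

Inductive term :=
| Var (v : nat) | Num (c : nat) | Bin (o : binop) (t u : term) | Get (t : term).

(* A variable is a register.  A formula at level [l] has its free variables
   below [l], and its code may overwrite the registers from [l] on.
   [Search t0 t f g] at level [l] binds a counter [l] and an accumulator
   [l.+1].  The counter runs through [0, ..., n - 1] while the accumulator
   starts with [t0] and is stepped by [t]; at the first state that satisfies
   [f] the answer is that of [g], and it is [false] if there is none. *)
Inductive form :=
| Cmp (c : comparison) (t u : term)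
| Not (f : form)
| And (f g : form)
| Search (t0 t : term) (f g : form).

(** Registers from [d] on serve as an evaluation stack, with the result left in [d]. [WOr] of a
    register with itself acts as a move. *)
Fixpoint tcode (d : nat) (t : term) : seq instr :=
  match t with
  | Var v => [:: Op WOr d v v]
  | Num c => [:: Const d c]
  | Bin o t u => tcode d t ++ tcode d.+1 u ++ [:: Op o d d d.+1]
  | Get t => tcode d t ++ [:: Read d d]
  end.

Fixpoint tsize (t : term) : nat :=
  match t with
  | Var _ | Num _ => 1
  | Bin _ t u => tsize t + (tsize u + 1)
  | Get t => tsize t + 1
  end.

Lemma size_tcode d t : size (tcode d t) = tsize t.
Proof.
elim: t d => //= [o t IHt u IHu|t IHt] d; rewrite !size_cat ?IHt ?IHu //.
Qed.

Fixpoint fsize (f : form) : nat :=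
  match f with
  | Cmp _ t u => tsize t + (tsize u + 2)
  | Not f => fsize f
  | And f g => fsize f + fsize g
  | Search t0 t f g =>
      1 + (tsize t0 + (1 + (fsize f + (tsize t + (4 + fsize g)))))
  end.

(** No boolean is stored: control leaves to [lt] or [lf], so [Not] is free and [And] short-circuits.
    Jumps are absolute, hence the start address [p]. In [Search], [h] is the loop head, [s] the code
    that steps the accumulator after [f] fails, and [q] the code of [g]. *)
Fixpoint fcode (p l : nat) (f : form) (lt lf : nat) : seq instr :=
  match f with
  | Cmp c t u =>
      tcode l t ++ tcode l.+1 u ++ [:: JumpIf c l l.+1 lt; Jump lf]
  | Not f => fcode p l f lf lt
  | And f g => fcode p l f (p + fsize f) lf ++ fcode (p + fsize f) l g lt lf
  | Search t0 t f g =>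
      let h := p.+1 + tsize t0 in
      let s := h.+1 + fsize f in
      let q := s + tsize t + 4 in
      [:: Const l 0] ++ tcode l.+1 t0 ++ [:: JumpIf WEq l 0 lf] ++
      fcode h.+1 l.+2 f q s ++ tcode l.+2 t ++
      [:: Op WOr l.+1 l.+2 l.+2; Const l.+2 1; Op WAdd l l l.+2; Jump h] ++
      fcode q l.+2 g lt lf
  end.

Lemma size_fcode p l f lt lf : size (fcode p l f lt lf) = fsize f.
Proof.
elim: f p l lt lf => [c t u|f IHf|f IHf g IHg|t0 t f IHf g IHg] p l lt lf //=;
  by do ?rewrite ?size_cat ?size_tcode ?IHf ?IHg /=.
Qed.

(** [g] runs at most once, so its cost stays outside the factor [n.+1]; this keeps chained searches
    quadratic. The 5 counts the loop-head test and the four instructions that close a round. *)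
Fixpoint cost (n : nat) (f : form) : nat :=
  match f with
  | Cmp _ t u => tsize t + (tsize u + 2)
  | Not f => cost n f
  | And f g => cost n f + cost n g
  | Search t0 t f g =>
      1 + tsize t0 + n.+1 * (cost n f + tsize t + 5) + cost n g
  end.

Fixpoint twf (d : nat) (t : term) : bool :=
  match t with
  | Var v => v < d
  | Num _ => true
  | Bin _ t u => twf d t && twf d u
  | Get t => twf d t
  end.

Fixpoint fwf (l : nat) (f : form) : bool :=
  match f with
  | Cmp _ t u => twf l t && twf l u
  | Not f => fwf l f
  | And f g => fwf l f && fwf l g
  | Search t0 t f g => [&& twf l.+1 t0, twf l.+2 t, fwf l.+2 f & fwf l.+2 g]
  end.

Lemma twfS d t : twf d t -> twf d.+1 t.
Proof.
by elim: t => //= [v /ltnW|o t IHt u IHu /andP[/IHt-> /IHu->]].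
Qed.

(** * Semantics of formulas and correctness of the compiler *)

Fixpoint first_sat (f g : nat -> bool) (i k : nat) : bool :=
  if k is k'.+1 then if f i then g i else first_sat f g i.+1 k' else false.

Lemma first_satP (f g : nat -> bool) i k :
  reflect (exists j, [/\ i <= j < i + k, f j, g j &
                         forall j', i <= j' < j -> ~~ f j'])
          (first_sat f g i k).
Proof.
elim: k i => [|k IH] i /=.
  by constructor=> -[j []]; lia.
case: ifP => fi.
  apply: (iffP idP) => [gi|[j [ij fj gj nj]]].
    by exists i; split=> // [|j]; lia.
  have [->//|ne] := eqVneq i j.
  have/nj : i <= i < j by lia.
  by rewrite fi.
apply: (iffP (IH _)) => -[j [ij fj gj nj]]; exists j; split=> //.
- by lia.
- move=> j' j'P; have [->|ne] := eqVneq j' i; first by rewrite fi.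
  by apply: nj; lia.
- suff: i != j by lia.
  by apply/eqP => ?; subst; rewrite fi in fj.
- by move=> j' ?; apply: nj; lia.
Qed.

Section Semantics.

Variables (w : nat) (m : nat -> nat).

(** Every constructor reduces modulo [2 ^ w], even [Var], because each register write does. *)
Fixpoint tval (t : term) (r : nat -> nat) : nat :=
  match t with
  | Var v => r v %% 2 ^ w
  | Num c => c %% 2 ^ w
  | Bin o t u => eval_op w o (tval t r) (tval u r) %% 2 ^ w
  | Get t => m (tval t r) %% 2 ^ w
  end.

Definition bind2 (r : nat -> nat) (l i a : nat) : nat -> nat :=
  update (update r l i) l.+1 a.

Fixpoint accu (l : nat) (t0 t : term) (r : nat -> nat) (i : nat) : nat :=
  if i is j.+1 then tval t (bind2 r l j (accu l t0 t r j))
  else tval t0 (update r l 0).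

Definition state l t0 t r i := bind2 r l i (accu l t0 t r i).

Fixpoint sem (l : nat) (f : form) (r : nat -> nat) : bool :=
  match f with
  | Cmp c t u => eval_cmp c (tval t r) (tval u r)
  | Not f => ~~ sem l f r
  | And f g => sem l f r && sem l g r
  | Search t0 t f g =>
      first_sat (fun i => sem l.+2 f (state l t0 t r i))
                (fun i => sem l.+2 g (state l t0 t r i)) 0 (r 0)
  end.

Definition agree (l : nat) (R r : nat -> nat) := forall v, v < l -> R v = r v.

Lemma tval_small t r : tval t r < 2 ^ w.
Proof. by case: t => *; apply: ltn_pmod; rewrite expn_gt0. Qed.

Lemma tval_agree d t R r : agree d R r -> twf d t -> tval t R = tval t r.
Proof.
move=> A; elim: t => //= [v vd|o t IHt u IHu /andP[wt wu]|t IHt wt].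
- by rewrite A.
- by rewrite IHt // IHu.
- by rewrite IHt.
Qed.

Variable P : program.

Lemma tcode_run t d p R r :
    code_at P p (tcode d t) -> agree d R r -> twf d t ->
  exists R', [/\ steps w P (tsize t) (Config p R m) (Config (p + tsize t) R' m),
                 R' d = tval t r & agree d R' r].
Proof.
elim: t d p R r => [v|c|o t IHt u IHu|t IHt] d p R r /=.
- case=> Pp _ Rr vd; exists (update R d (tval (Var v) r)); split.
  + rewrite addn1 /=.
    have := steps1 w (Config p R m) Pp; rewrite /= /set_reg /=.
    by rewrite Rr // PeanoNat.Nat.lor_diag; exact.
  + by rewrite /update eqxx.
  + by move=> x xd; rewrite /update ltn_eqF // Rr.
- case=> Pp _ Rr _; exists (update R d (tval (Num c) r)); split.
  + rewrite addn1; have := steps1 w (Config p R m) Pp.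
    by exact.
  + by rewrite /update eqxx.
  + by move=> x xd; rewrite /update ltn_eqF // Rr.
- move=> /code_at_cat[Pt] /code_at_cat[Pu [Po _]] Rr /andP[wt wu].
  rewrite !size_tcode in Pu Po.
  have [R1 [S1 V1 A1]] := IHt _ _ _ _ Pt Rr wt.
  (* With [R1] itself as the environment one level up, the run of [u] must preserve register [d],
     which holds the value of [t]. *)
  have A1' : agree d.+1 R1 R1 by [].
  have [R2 [S2 V2 A2]] := IHu _ _ _ _ Pu A1' (twfS wu).
  exists (update R2 d (tval (Bin o t u) r)); split.
  + rewrite addnA; apply: steps_trans; first by apply: steps_trans S1 S2.
    rewrite !addnA addn1.
    have := steps1 w (Config (p + tsize t + tsize u) R2 m) Po.
    rewrite /= /set_reg /= A2 // V1 V2.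
    by rewrite (tval_agree A1 wu); exact.
  + by rewrite /update eqxx.
  + move=> x xd; rewrite /update ltn_eqF // A2; last exact: ltnW.
    exact: A1.
- move=> /code_at_cat[Pt [Po _]] Rr wt; rewrite size_tcode in Po.
  have [R1 [S1 V1 A1]] := IHt _ _ _ _ Pt Rr wt.
  exists (update R1 d (tval (Get t) r)); split.
  + apply: steps_trans S1 _.
    rewrite addnA addn1.
    have := steps1 w (Config (p + tsize t) R1 m) Po.
    by rewrite /= /set_reg /= V1; exact.
  + by rewrite /update eqxx.
  + by move=> x xd; rewrite /update ltn_eqF // A1.
Qed.

Lemma agree_state l t0 t R r i : agree l R r -> R l = i ->
  R l.+1 = accu l t0 t r i -> agree l.+2 R (state l t0 t r i).
Proof.
move=> A Rl Rl1 v; rewrite /state /bind2 /update.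
case: eqVneq => [->//|vl1]; case: eqVneq => [->//|vl vl2].
by apply: A; lia.
Qed.

Lemma state_agree l t0 t R r i : agree l.+2 R (state l t0 t r i) -> agree l R r.
Proof.
move=> A v vl; rewrite A; last lia.
by rewrite /state /bind2 /update !ltn_eqF //; lia.
Qed.

(** The machine registers [R] and the environment [r] are related only below [l]. [0 < l] protects
    the loop bound in register 0, and [r 0 < 2 ^ w] keeps loop counters from wrapping around. *)
Lemma fcode_run f l p lt lf R r :
    code_at P p (fcode p l f lt lf) -> agree l R r -> fwf l f -> 0 < l ->
    r 0 < 2 ^ w ->
  exists t R', [/\ t <= cost (r 0) f,
    steps w P t (Config p R m) (Config (if sem l f r then lt else lf) R' m)
    & agree l R' r].
Proof.
elim: f l p lt lf R r
  => [c t u|f IHf|f IHf g IHg|t0 t f IHf g IHg] l p lt lf R r /=.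
- move=> /code_at_cat[Pt] /code_at_cat[Pu [Pc [Pj _]]] Rr /andP[wt wu] l0 n_w.
  rewrite !size_tcode in Pu Pc Pj.
  have [R1 [S1 V1 A1]] := tcode_run Pt Rr wt.
  have A1' : agree l.+1 R1 R1 by [].
  have [R2 [S2 V2 A2]] := tcode_run Pu A1' (twfS wu).
  have AR : agree l R2 r by move=> x xl; rewrite A2 1?ltnW // A1.
  have S12 := steps_trans S1 S2.
  have S3 := steps1 w (Config (p + tsize t + tsize u) R2 m) Pc I.
  rewrite /= V2 (A2 l) // V1 (tval_agree A1 wu) in S3.
  case: ifP S3 => C S3.
    exists (tsize t + tsize u + 1), R2; split=> //; first by lia.
    exact: steps_trans S12 S3.
  exists (tsize t + tsize u + 1 + 1), R2; split=> //; first by lia.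
  apply: steps_trans (steps_trans S12 S3) _.
  exact: (steps1 w (Config (p + tsize t + tsize u).+1 R2 m) Pj I).
- move=> Pf Rr wf l0 n_w.
  have [t1 [R1 [T1 S1 A1]]] := IHf _ _ _ _ _ _ Pf Rr wf l0 n_w.
  by exists t1, R1; split=> //; move: S1; case: (sem l f r).
- move=> /code_at_cat[Pf]; rewrite size_fcode => Pg Rr /andP[wf wg] l0 n_w.
  have [t1 [R1 [T1 S1 A1]]] := IHf _ _ _ _ _ _ Pf Rr wf l0 n_w.
  move: S1; case: (sem l f r) => S1 /=; last first.
    by exists t1, R1; split=> //; lia.
  have [t2 [R2 [T2 S2 A2]]] := IHg _ _ _ _ _ _ Pg A1 wg l0 n_w.
  by exists (t1 + t2), R2; split=> //; [lia | exact: steps_trans S1 S2].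
set h := p.+1 + tsize t0; set s := h.+1 + fsize f; set q := s + tsize t + 4.
move=> [P0] /code_at_cat[Pt0]; rewrite size_tcode -/h.
case=> Ph /code_at_cat[Pf]; rewrite size_fcode -/s.
case/code_at_cat=> Pt; rewrite size_tcode.
case=> Pm [Po [Pi [Pj Pg]]].
have {}Pg : code_at P q (fcode q l.+2 g lt lf).
  have qE : q = (s + tsize t).+4 by rewrite /q addn4.
  by rewrite {1}qE.
move=> Rr /and4P[wt0 wt wf wg] l0 n_w.
have w0 : 0 < 2 ^ w by rewrite expn_gt0.
have S0 := steps1 w (Config p R m) P0 I.
rewrite /= /set_reg /= mod0n in S0.
have A0 : agree l.+1 (update R l 0) (update r l 0).
  move=> v vl; rewrite /update; case: eqP => // vl'; apply: Rr; lia.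
have [R1 [S1 V1 A1]] := tcode_run Pt0 A0 wt0.
rewrite -/h in S1.
have {A0} A1' : agree l.+2 R1 (state l t0 t r 0).
  apply: agree_state => //.
    move=> v vl; rewrite A1; last lia.
    by rewrite /update ltn_eqF.
  by rewrite A1 // /update eqxx.
pose F i := sem l.+2 f (state l t0 t r i).
pose G i := sem l.+2 g (state l t0 t r i).
rewrite -/F -/G.
have st0 i : state l t0 t r i 0 = r 0.
  by rewrite /state /bind2 /update !ltn_eqF //; lia.
have stl i : state l t0 t r i l = i.
  by rewrite /state /bind2 /update eqxx ltn_eqF.
(* Induction on the number [k] of remaining rounds. The summands outside the product pay for the
   exit: the last head test, or a successful [f] followed by [g]. *)
have loop k i R2 : i + k = r 0 -> agree l.+2 R2 (state l t0 t r i) ->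
  exists t1 R', [/\ t1 <= k * (cost (r 0) f + tsize t + 5) + 1 +
                          (cost (r 0) f + cost (r 0) g),
   steps w P t1 (Config h R2 m)
     (Config (if first_sat F G i k then lt else lf) R' m) & agree l R' r].
  elim: k i R2 => [|k IHk] i R2 ik A2.
    exists 1, R2; split; [lia | | exact: state_agree A2].
    have := steps1 w (Config h R2 m) Ph I.
    rewrite /= !A2 //.
    by rewrite st0 stl -ik addn0 eqxx; exact.
  have Sh := steps1 w (Config h R2 m) Ph I.
  rewrite /= !A2 // st0 stl in Sh.
  rewrite (_ : (i == r 0) = false) in Sh; last lia.
  have [t3 [R3 [T3 S3 A3]]] :=
    IHf _ _ _ _ _ _ Pf A2 wf isT (eq_ind_r (fun x => x < _) n_w (st0 i)).
  rewrite st0 in T3.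
  have S13 := steps_trans Sh S3.
  rewrite /= /F; move: S13; rewrite -/(F i) -/(G i).
  case Fi: (F i) => S13.
    have [t4 [R4 [T4 S4 A4]]] :=
      IHg _ _ _ _ _ _ Pg A3 wg isT (eq_ind_r (fun x => x < _) n_w (st0 i)).
    rewrite st0 in T4.
    exists (1 + t3 + t4), R4; split; [nia | exact: steps_trans S13 S4 |].
    exact: state_agree A4.
  have [R4 [S4 V4 A4]] := tcode_run Pt A3 wt.
  have Sm := steps1 w (Config (s + tsize t) R4 m) Pm I.
  rewrite /= /set_reg /= PeanoNat.Nat.lor_diag V4 in Sm.
  rewrite modn_small ?tval_small // in Sm.
  set R5 := update _ _ _ in Sm.
  have So := steps1 w (Config (s + tsize t).+1 R5 m) Po I.
  rewrite /= /set_reg /= in So.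
  set R6 := update _ _ _ in So.
  have Si := steps1 w (Config (s + tsize t).+2 R6 m) Pi I.
  rewrite /= /set_reg /= in Si.
  have R6l : R6 l = i.
    by rewrite /R6 /R5 /update !ltn_eqF // A4 // stl.
  have R6l2 : R6 l.+2 = 1.
    by rewrite /R6 /update eqxx modn_small //; lia.
  rewrite R6l R6l2 addn1 modn_small in Si; last lia.
  set R7 := update _ _ _ in Si.
  have Sj := steps1 w (Config (s + tsize t).+3 R7 m) Pj I.
  rewrite /= in Sj.
  have A7 : agree l.+2 R7 (state l t0 t r i.+1).
    apply: agree_state.
    - move=> v vl; rewrite /R7 /R6 /R5 /update !ltn_eqF //; try lia.
      by rewrite (state_agree A4).
    - by rewrite /R7 /update eqxx.
    - by rewrite /R7 /R6 /R5 /update !eqxx gtn_eqF // ltn_eqF.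
  have [||t8 [R8 [T8 S8 A8]]] := IHk i.+1 R7; [lia | by [] |].
  exists (1 + t3 + tsize t + 1 + 1 + 1 + 1 + t8), R8; split=> //; first nia.
  apply: steps_trans S8; apply: steps_trans Sj; apply: steps_trans Si.
  apply: steps_trans So; apply: steps_trans Sm; exact: steps_trans S4.
have [t2 [R2 [T2 S2 A2]]] := loop (r 0) 0 R1 (add0n _) A1'.
exists (1 + tsize t0 + t2), R2; split=> //; first nia.
by apply: steps_trans S2; apply: steps_trans S1.
Qed.

End Semantics.

(** * Soundness: the tests over pairs imply the field axioms *)

Section Soundness.

Variables (F : finType) (add mul : F -> F -> F) (z e g : F) (i0 : nat).
Hypotheses (add0 : left_id z add) (mul1 : left_id e mul) (e_neq_z : e <> z).
Hypotheses (mul0 : left_zero z mul) (addN : forall x, exists y, add y x = z).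
Hypotheses (addC : commutative add) (mulC : commutative mul).
Hypotheses (mul_gA : forall x y, mul g (mul x y) = mul (mul g x) y).
Hypotheses (mul_gD : forall x y, mul g (add x y) = add (mul g x) (mul g y)).
Hypotheses (add_eA : forall x y, add e (add x y) = add (add e x) y).
Hypotheses (i0n : i0.+2 = #|F|) (g_i0 : iter i0 (mul g) g = e).
Hypothesis (g_lt : forall i, i < i0 -> iter i (mul g) g <> e).

(** The power [g ^ i]. The hypotheses iterate from [g] instead of [e], which shifts the exponent by
    one. *)
Let pw i := iter i (mul g) e.

Let pwS i : pw i.+1 = iter i (mul g) g.
Proof. by rewrite /pw iterSr mulC mul1. Qed.

Let pw_mulA i x y : mul (pw i) (mul x y) = mul (mul (pw i) x) y.
Proof.
elim: i => [|i IH]; first by rewrite /pw /= !mul1.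
by rewrite {1}/pw iterS -mul_gA IH mul_gA mul_gA.
Qed.

Let pw_mulD i x y : mul (pw i) (add x y) = add (mul (pw i) x) (mul (pw i) y).
Proof.
elim: i => [|i IH]; first by rewrite /pw /= !mul1.
by rewrite /pw iterS -!mul_gA IH mul_gD.
Qed.

Let pwD i j : pw (i + j) = mul (pw i) (pw j).
Proof.
elim: i => [|i IH]; first by rewrite /pw /= mul1.
by rewrite addSn {1}/pw iterS -/(pw _) IH mul_gA.
Qed.

Let pw_order : pw i0.+1 = e. Proof. by rewrite pwS. Qed.

Let pw_inv i : i <= i0.+1 -> mul (pw (i0.+1 - i)) (pw i) = e.
Proof. by move=> le_i; rewrite -pwD subnK. Qed.

(** A power equal to [z] would, multiplied by its inverse power, give [z = e]. *)
Let pw_neq0 i : i <= i0.+1 -> pw i <> z.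
Proof. by move=> /pw_inv + pz; rewrite pz mulC mul0 => /esym. Qed.

(** Multiplying [g ^ i = g ^ j] by the inverse of [g ^ i] gives [g ^ (j - i) = e], against the
    minimality in [g_lt]. *)
Let pw_inj_lt i j : i < j -> j < i0.+1 -> pw i <> pw j.
Proof.
move=> ij jN pij; have iN : i <= i0.+1 by lia.
have := pw_inv iN; rewrite pij -pwD.
rewrite (_ : _ - _ + _ = i0.+1 + (j - i.+1).+1); last lia.
by rewrite pwD pw_order mul1 pwS; apply: g_lt; lia.
Qed.

(** Counting: [z] and the powers with exponents [0, ..., i0] are [i0.+2 = #|F|] distinct
    elements. *)
Lemma powers_cover x : x <> z -> exists2 i, i <= i0 & x = pw i.
Proof.
pose s := z :: map pw (iota 0 i0.+1).
have s_uniq : uniq s.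
  rewrite cons_uniq map_inj_in_uniq ?iota_uniq ?andbT.
    by apply/mapP => -[i]; rewrite mem_iota => ? /esym; apply: pw_neq0; lia.
  move=> i j; rewrite !mem_iota => iN jN pij.
  case: (ltngtP i j) => // ij.
    by case: (pw_inj_lt ij _ pij); lia.
  by case: (pw_inj_lt ij _ (esym pij)); lia.
have [_ sE] : (size s = size (enum F)) * (s =i enum F).
  apply: uniq_min_size => // [y _|]; first by rewrite mem_enum.
  by rewrite -cardE -i0n /= size_map size_iota.
move=> x0; have : x \in s by rewrite sE mem_enum.
rewrite inE => /orP[/eqP//|/mapP[i]]; rewrite mem_iota => ? ->.
by exists i => //; lia.
Qed.

Lemma generator_field_axioms : field_axioms add mul z e.
Proof.
split=> //.
- move=> x; have [->|/eqP/powers_cover[i le_i ->]] := eqVneq x z.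
    by move=> y t; rewrite !add0.
  (* Since [pw i] acts invertibly, [y] and [t] may be written as its multiples; the identity then is
     [pw i] times an instance of [add_eA]. *)
  have pwK y : mul (pw i) (mul (pw (i0.+1 - i)) y) = y.
    by rewrite pw_mulA -pwD subnKC ?pw_order ?mul1 //; lia.
  have peE : mul (pw i) e = pw i by rewrite mulC mul1.
  move=> y t; rewrite -[y]pwK -[t]pwK.
  set y1 := mul _ y; set t1 := mul _ t.
  by have := congr1 (mul (pw i)) (add_eA y1 t1); rewrite !pw_mulD peE.
- move=> x; have [->|/eqP/powers_cover[i le_i ->]] := eqVneq x z.
    by move=> y t; rewrite !mul0.
  by move=> y t; apply: pw_mulA.
- move=> x /powers_cover[i le_i ->]; exists (pw (i0.+1 - i)).
  by apply: pw_inv; lia.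
- move=> x y t; rewrite !(mulC _ t).
  have [->|/eqP/powers_cover[i le_i ->]] := eqVneq t z; last exact: pw_mulD.
  by rewrite !mul0 add0.
Qed.

End Soundness.

(** * Completeness: a finite field has a generator of the required order *)

Section Completeness.

Variables (F : finType) (add mul : F -> F -> F) (z e : F).
Hypothesis (axF : field_axioms add mul z e).

Let opp x := odflt z [pick y | add y x == z].

Let addN : left_inverse z opp add.
Proof.
move=> x; rewrite /opp; case: pickP => [y /eqP//|no].
by have [y /eqP] := field_addN axF x; rewrite no.
Qed.

(** The axioms give inverses only by existence, so one is picked; zero is its own inverse by the
    library convention. *)
Let inv x := if x == z then z else odflt z [pick y | mul y x == e].

Let mulV x : x != z -> mul (inv x) x = e.
Proof.
rewrite /inv => x0; rewrite (negPf x0); case: pickP => [y /eqP//|no].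
by have [y /eqP] := field_mulV axF (elimN eqP x0); rewrite no.
Qed.

Let inv0 : inv z = z. Proof. by rewrite /inv eqxx. Qed.

Let e_neq0 : e != z. Proof. by apply/eqP; case: axF. Qed.

Local Notation addA := (field_addA axF).
Local Notation addC := (field_addC axF).
Local Notation add0 := (field_add0 axF).
Local Notation mulA := (field_mulA axF).
Local Notation mulC := (field_mulC axF).
Local Notation mul1 := (field_mul1 axF).
Local Notation mulD := (field_mulD axF).

(** A copy of [F] to carry the field structure, so that the theory of roots of unity applies. *)
Definition carrier : Type := F.
HB.instance Definition _ := Finite.on carrier.
HB.instance Definition _ := GRing.isZmodule.Build carrier addA addC add0 addN.
HB.instance Definition _ :=
  GRing.Zmodule_isComNzRing.Build carrier mulA mulC mul1 mulD e_neq0.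
HB.instance Definition _ := GRing.ComNzRing_isField.Build carrier mulV inv0.

(** The [#|F| - 1] nonzero elements are all roots of unity of that order; so many roots in a field
    force a primitive one. *)
Lemma field_generator : exists g, exists i0,
  [/\ i0.+2 = #|F|, iter i0 (mul g) g = e &
      forall i, i < i0 -> iter i (mul g) g <> e].
Proof.
have n2 : 1 < #|F| by apply/card_gt1P; exists e, z.
have iterE (g : carrier) i : iter i (mul g) g = (g ^+ i.+1)%R.
  by elim: i => //= i ->; exact/esym/(GRing.exprS g).
pose i0 := #|F| - 2; have i0n : i0.+2 = #|F| by rewrite /i0; lia.
pose s : seq carrier := [seq x <- enum {: carrier} | x != z].
have card_carrier : #|{: carrier}| = #|F|.
  by apply: (bij_eq_card (f := id : carrier -> F)); exists id.
have /hasP[g _ gP] : has (i0.+1).-primitive_root%R s.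
  apply: has_prim_root => //.
  (* Cancel [x] in [x ^ #|F| = x]. *)
  - apply/allP => x; rewrite mem_filter => /andP[x0 _].
    apply/unity_rootP; apply: (@GRing.mulfI carrier x x0).
    by rewrite -GRing.exprS i0n GRing.mulr1 -card_carrier (@expf_card carrier).
  - by rewrite filter_uniq ?enum_uniq.
  (* Filtering out [z] removes at most one element, so at least [i0.+1] remain. *)
  - have := count_predC (fun x : carrier => x != z) (enum {: carrier}).
    rewrite -cardE card_carrier -i0n size_filter.
    have -> := @eq_count carrier (predC (fun x => x != z)) (pred1 z)
                 (fun x => negbK _).
    rewrite count_uniq_mem ?enum_uniq // => cnt.
    by rewrite -(leq_add2r 1) addn1 -cnt leq_add2l leq_b1.
exists g, i0; split=> //; first by rewrite iterE (prim_expr_order gP).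
move=> i lt_i; rewrite iterE => gi.
by have := prim_order_dvd gP i.+1; rewrite gi eqxx => /dvdn_leq; lia.
Qed.

End Completeness.

(** * The field test as a formula *)

Definition tplus t u := Get (Bin WAdd (Bin WMul (Var 0) t) u).

(** The tables are row-major, and the [n * n] entries of the addition come first. *)
Definition ttimes t u :=
  Get (Bin WAdd (Bin WMul (Var 0) (Var 0)) (Bin WAdd (Bin WMul (Var 0) t) u)).

Definition Eq := Cmp WEq.
(** The accumulator is a dummy but still occupies a register, so nested searches bind the odd
    registers 1, 3, 5, 7, 9. *)
Definition Find := Search (Num 0) (Num 0).
Definition Ex f := Find f (Eq (Num 0) (Num 0)).
Definition All f := Not (Ex (Not f)).

Definition zero_form := All (Eq (tplus (Var 1) (Var 3)) (Var 3)).

Definition one_form := All (Eq (ttimes (Var 3) (Var 5)) (Var 5)).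

(** When the counter 7 is [i], the accumulator 8 holds [g ^ i.+1]. One multiplication per round
    makes the test of a candidate linear. *)
Definition generator_form :=
  Search (Var 5) (ttimes (Var 5) (Var 8))
    (Eq (Var 8) (Var 3)) (Eq (Bin WAdd (Var 7) (Num 2)) (Var 0)).

(** That zero annihilates is tested explicitly: soundness uses it to see that powers of [g] are
    nonzero and to treat zero factors. *)
Definition unary_form :=
  All (And (Eq (ttimes (Var 1) (Var 7)) (Var 1))
           (Ex (Eq (tplus (Var 9) (Var 7)) (Var 1)))).

Definition binary_form :=
  All (All
    (And (Eq (tplus (Var 7) (Var 9)) (tplus (Var 9) (Var 7)))
    (And (Eq (ttimes (Var 7) (Var 9)) (ttimes (Var 9) (Var 7)))
    (And (Eq (ttimes (Var 5) (ttimes (Var 7) (Var 9)))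
             (ttimes (ttimes (Var 5) (Var 7)) (Var 9)))
    (And (Eq (ttimes (Var 5) (tplus (Var 7) (Var 9)))
             (tplus (ttimes (Var 5) (Var 7)) (ttimes (Var 5) (Var 9))))
         (Eq (tplus (Var 3) (tplus (Var 7) (Var 9)))
             (tplus (tplus (Var 3) (Var 7)) (Var 9)))))))).

(* Variables 1, 3, 5 hold the zero, the one and the generator. *)
Definition field_form :=
  Find zero_form (Find one_form (Find generator_form
    (And (Not (Eq (Var 3) (Var 1))) (And unary_form binary_form)))).

(** * Reading the Cayley tables and interpreting the formulas *)

Lemma nth_allpairs (S T R : Type) (f : S -> T -> R) x0 y0 r0 s t i j :
  i < size s -> j < size t ->
  nth r0 [seq f x y | x <- s, y <- t] (size t * i + j) =
    f (nth x0 s i) (nth y0 t j).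
Proof.
elim: s i => // x s IH [|i] /= i_s j_t.
  by rewrite muln0 nth_cat size_map j_t (nth_map y0).
rewrite nth_cat size_map ltnNge mulnS -addnA leq_addr /=.
by rewrite addKn IH.
Qed.

Section Field.

Variables (F : finType) (add mul : F -> F -> F) (w : nat).
(** Room for all table addresses, which are below [2 * n ^ 2], and for the sum [i + 2] in the
    generator test. *)
Hypothesis wP : 2 * #|F| ^ 2 + 2 < 2 ^ w.

Local Notation n := #|F|.
Local Notation m := (nth 0 (cayley add ++ cayley mul)).
Local Notation sem := (sem w m).
Local Notation tval := (tval w m).

Definition enc (x : F) : nat := enum_rank x.

Lemma enc_lt x : enc x < n. Proof. exact: ltn_ord. Qed.

Lemma enc_inj : injective enc.
Proof. by move=> x y /val_inj/enum_rank_inj. Qed.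

Lemma enc_onto i : i < n -> exists x, i = enc x.
Proof.
by move=> i_n; exists (enum_val (Ordinal i_n)); rewrite /enc enum_valK.
Qed.

Lemma nth_cayley (op : F -> F -> F) x y :
  nth 0 (cayley op) (n * enc x + enc y) = enc (op x y).
Proof.
have := @nth_allpairs _ _ _ (fun x y => enc (op x y)) x y 0 (enum F) (enum F)
  (enc x) (enc y).
by rewrite -cardE !nth_enum_rank => ->; rewrite ?enc_lt.
Qed.

Lemma size_cayley (op : F -> F -> F) : size (cayley op) = n * n.
Proof. by rewrite size_allpairs -cardE. Qed.

Lemma tval_var r v x : r v = enc x -> tval (Var v) r = enc x.
Proof. by move=> /= ->; rewrite modn_small //; have := enc_lt x; nia. Qed.

Lemma tval_plus r t u x y : r 0 = n -> tval t r = enc x -> tval u r = enc y ->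
  tval (tplus t u) r = enc (add x y).
Proof.
move=> r0 tx uy; rewrite /= r0 tx uy.
have := enc_lt x; have := enc_lt y => ltx lty.
rewrite (modn_small (m := n)); last nia.
rewrite (modn_small (m := n * enc x)); last nia.
rewrite (modn_small (m := n * enc x + enc y)); last nia.
rewrite nth_cat size_cayley ifT; last nia.
rewrite nth_cayley modn_small //; have := enc_lt (add x y); nia.
Qed.

Lemma tval_times r t u x y : r 0 = n -> tval t r = enc x -> tval u r = enc y ->
  tval (ttimes t u) r = enc (mul x y).
Proof.
move=> r0 tx uy; rewrite /= r0 tx uy.
have := enc_lt x; have := enc_lt y => ltx lty.
rewrite (modn_small (m := n)); last nia.
rewrite (modn_small (m := n * enc x)); last nia.
rewrite (modn_small (m := n * enc x + enc y)); last nia.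
rewrite (modn_small (m := n * n)); last nia.
rewrite (modn_small (m := n * n + _)); last nia.
rewrite nth_cat size_cayley ifF; last lia.
rewrite addKn nth_cayley modn_small //; have := enc_lt (mul x y); nia.
Qed.

Lemma sem_Eq l r t u x y : tval t r = enc x -> tval u r = enc y ->
  sem l (Eq t u) r = (x == y).
Proof. by move=> /= -> ->; rewrite (inj_eq enc_inj). Qed.

Lemma sem_Search l t0 t f g r :
  sem l (Search t0 t f g) r =
  first_sat (fun i => sem l.+2 f (state w m l t0 t r i))
            (fun i => sem l.+2 g (state w m l t0 t r i)) 0 (r 0).
Proof. by []. Qed.

Lemma sem_Not l f r : sem l (Not f) r = ~~ sem l f r.
Proof. by []. Qed.

Lemma sem_And l f g r : sem l (And f g) r = sem l f r && sem l g r.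
Proof. by []. Qed.

Lemma state_Find l r i : state w m l (Num 0) (Num 0) r i = bind2 r l i 0.
Proof. by rewrite /state; case: i => [|i] /=; rewrite mod0n. Qed.

Lemma sem_Find l f g r : r 0 = n -> sem l (Find f g) r ->
  exists x, sem l.+2 f (bind2 r l (enc x) 0) /\
            sem l.+2 g (bind2 r l (enc x) 0).
Proof.
move=> r0; rewrite sem_Search => /first_satP[i []].
rewrite r0 add0n => /= /enc_onto[x ->].
by rewrite !state_Find; exists x.
Qed.

(** A search commits to its first hit, which depends on the enumeration of [F]; hence [g] is
    required at every element that satisfies [f]. *)
Lemma Find_sem l f g r x : r 0 = n -> sem l.+2 f (bind2 r l (enc x) 0) ->
    (forall y, sem l.+2 f (bind2 r l (enc y) 0) ->
               sem l.+2 g (bind2 r l (enc y) 0)) ->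
  sem l (Find f g) r.
Proof.
move=> r0 fx fg; rewrite sem_Search; apply/first_satP.
have ex_i : exists i, (i < n) && sem l.+2 f (bind2 r l i 0).
  by exists (enc x); rewrite enc_lt.
have [i /andP[i_n fi] i_min] := find_ex_minn ex_i.
have [y iy] := enc_onto i_n.
exists i; rewrite /= !state_Find r0; split=> //.
  by rewrite iy fg // -iy.
move=> j j_i; rewrite state_Find; apply/negP => fj.
by have := i_min j; rewrite fj (ltn_trans j_i i_n) leqNgt j_i => /(_ isT).
Qed.

Lemma sem_Ex l f r : r 0 = n ->
  sem l (Ex f) r = [exists x, sem l.+2 f (bind2 r l (enc x) 0)].
Proof.
move=> r0; apply/idP/existsP => [/(sem_Find r0)[x []]|[x fx]].
  by exists x.
by apply: (Find_sem (x := x)) => // y _ /=; rewrite eqxx.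
Qed.

Lemma sem_All l f r : r 0 = n ->
  sem l (All f) r = [forall x, sem l.+2 f (bind2 r l (enc x) 0)].
Proof.
move=> r0; rewrite [LHS]/(~~ sem l (Ex (Not f)) r) sem_Ex //.
by apply/existsPn/forallP => all_f x; have := all_f x; rewrite /= negbK.
Qed.

Ltac eval_term :=
  solve [repeat first [apply: tval_plus | apply: tval_times | apply: tval_var];
         try reflexivity; assumption].

Lemma sem_zero r z : r 0 = n -> r 1 = enc z ->
  sem 3 zero_form r = [forall x, add z x == x].
Proof.
move=> r0 r1; rewrite sem_All //; apply: eq_forallb => x.
apply: sem_Eq; eval_term.
Qed.

Lemma sem_one r e : r 0 = n -> r 3 = enc e ->
  sem 5 one_form r = [forall x, mul e x == x].
Proof.
move=> r0 r3; rewrite sem_All //; apply: eq_forallb => x.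
apply: sem_Eq; eval_term.
Qed.

Lemma sem_unary r z : r 0 = n -> r 1 = enc z ->
  sem 7 unary_form r =
    [forall x, (mul z x == z) && [exists y, add y x == z]].
Proof.
move=> r0 r1; rewrite sem_All //; apply: eq_forallb => x; rewrite sem_And.
congr andb; first by apply: sem_Eq; eval_term.
rewrite sem_Ex //; apply: eq_existsb => y.
apply: sem_Eq; eval_term.
Qed.

Lemma sem_binary r e g : r 0 = n -> r 3 = enc e -> r 5 = enc g ->
  sem 7 binary_form r =
    [forall x, forall y,
      [&& add x y == add y x, mul x y == mul y x,
          mul g (mul x y) == mul (mul g x) y,
          mul g (add x y) == add (mul g x) (mul g y) &
          add e (add x y) == add (add e x) y]].
Proof.
move=> r0 r3 r5; rewrite sem_All //; apply: eq_forallb => x.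
rewrite sem_All //; apply: eq_forallb => y.
rewrite !sem_And.
by congr [&& _, _, _, _ & _]; apply: sem_Eq; eval_term.
Qed.

Lemma sem_generator r e g : r 0 = n -> r 3 = enc e -> r 5 = enc g ->
  reflect (exists i, [/\ i.+2 = n, iter i (mul g) g = e &
                         forall j, j < i -> iter j (mul g) g <> e])
          (sem 7 generator_form r).
Proof.
move=> r0 r3 r5.
pose a := accu w m 7 (Var 5) (ttimes (Var 5) (Var 8)) r.
(* The accumulator invariant. *)
have accuE i : a i = enc (iter i (mul g) g).
  elim: i => [|i IH]; first by apply: tval_var.
  rewrite iterS -[LHS]/(tval (ttimes (Var 5) (Var 8)) (bind2 r 7 i (a i))).
  by apply: tval_times => //; apply: tval_var.
have accu_e i : sem 9 (Eq (Var 8) (Var 3))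
    (state w m 7 (Var 5) (ttimes (Var 5) (Var 8)) r i)
    = (iter i (mul g) g == e).
  by apply: sem_Eq; apply: tval_var => //; apply: accuE.
have countE i : i < n -> sem 9 (Eq (Bin WAdd (Var 7) (Num 2)) (Var 0))
    (state w m 7 (Var 5) (ttimes (Var 5) (Var 8)) r i) = (i.+2 == n).
  move=> i_n; rewrite /= /state /bind2 /update /= r0.
  by rewrite !modn_small ?addn2 //; nia.
rewrite sem_Search.
apply: (iffP (first_satP _ _ _ _)) => -[i []]; rewrite -/sem ?r0 ?add0n => i_n.
  rewrite accu_e => /eqP ie; rewrite countE // => /eqP iN nj.
  exists i; split=> // j j_i je; have := nj j; rewrite accu_e je eqxx /= j_i.
  by move/(_ isT).
move=> ie nj; exists i; rewrite accu_e countE ?ie ?eqxx; last lia.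
split=> //; [lia | exact/eqP | move=> j j_i].
by rewrite accu_e; apply/eqP/nj.
Qed.

Lemma sem_field_form r : r 0 = n -> sem 1 field_form r <-> is_field add mul.
Proof.
move=> r0; split.
  case/(sem_Find r0) => z [+]; rewrite (sem_zero (z := z)) // => /forallP add0.
  case/(sem_Find r0) => e [+]; rewrite (sem_one (e := e)) // => /forallP mul1.
  case/(sem_Find r0) => g [/(@sem_generator _ e g)[]// i0 [i0n gi0 g_lt]].
  rewrite !sem_And sem_Not => /and3P[].
  rewrite (sem_Eq _ (x := e) (y := z)); [|exact: tval_var|exact: tval_var].
  move=> e_neq_z.
  rewrite (sem_unary (z := z)) // => /forallP U.
  rewrite (sem_binary (e := e) (g := g)) // => /forallP B.
  have {}B x y := andP (forallP (B x) y).
  exists z, e; apply: (@generator_field_axioms F add mul z e g i0) => //.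
  - by move=> x; apply/eqP.
  - by move=> x; apply/eqP.
  - exact/eqP.
  - by move=> x; have /andP[/eqP] := U x.
  - by move=> x; have /andP[_ /existsP[y /eqP]] := U x; exists y.
  - by move=> x y; have [/eqP] := B x y.
  - by move=> x y; have [_ /and4P[/eqP]] := B x y.
  - by move=> x y; have [_ /and4P[_ /eqP]] := B x y.
  - by move=> x y; have [_ /and4P[_ _ /eqP]] := B x y.
  - by move=> x y; have [_ /and4P[_ _ _ /eqP]] := B x y.
case=> z [e ax].
have [g gen] := field_generator ax.
apply: (Find_sem (x := z)) => //.
  rewrite (sem_zero (z := z)) //; apply/forallP => x.
  by rewrite (field_add0 ax).
(* The identity of a commutative operation is unique, so the hit of the search is [z]; likewise for
   [e] below. *)
move=> z'; rewrite (sem_zero (z := z')) // => /forallP/(_ z)/eqP.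
rewrite (field_addC ax) (field_add0 ax) => ->.
apply: (Find_sem (x := e)) => //.
  rewrite (sem_one (e := e)) //; apply/forallP => x.
  by rewrite (field_mul1 ax).
move=> e'; rewrite (sem_one (e := e')) // => /forallP/(_ e)/eqP.
rewrite (field_mulC ax) (field_mul1 ax) => ->.
apply: (Find_sem (x := g)) => //.
  by apply/(@sem_generator _ e g).
(* The remaining tests hold in a field for any [g], so it does not matter which generator was
   found. *)
move=> {gen} {}g _.
rewrite !sem_And sem_Not.
rewrite (sem_Eq _ (x := e) (y := z)); [|exact: tval_var|exact: tval_var].
rewrite (sem_unary (z := z)) // (sem_binary (e := e) (g := g)) //.
(* Expand [z x = (z + z) x = z x + z x] and cancel with the negative [y] of [z x]. *)
have mul0 x : mul z x = z.
  have [y yzx] := field_addN ax (mul z x).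
  rewrite -[RHS]yzx -[in RHS](field_add0 ax z) (field_mulD ax) (field_addA ax).
  by rewrite yzx (field_add0 ax).
apply/and3P; split; first by apply/eqP; case: ax.
  apply/forallP => x; rewrite mul0 eqxx.
  by have [y yx] := field_addN ax x; apply/existsP; exists y; apply/eqP.
apply/forallP => x; apply/forallP => y.
apply/and5P; split; apply/eqP.
- exact: (field_addC ax).
- exact: (field_mulC ax).
- exact: (field_mulA ax).
- by rewrite !(field_mulC ax g) (field_mulD ax).
- exact: (field_addA ax).
Qed.

End Field.

(** * The decision program, its running time and its word size *)

Definition decide (f : form) : program :=
  let l := fsize f in
  fcode 0 1 f l l.+2 ++ [:: Const 1 1; Halt 1; Const 1 0; Halt 1].

(** Formulas start at level 1 because register 0 holds [n]. The extra 2 pays for loading the answer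
    and for [Halt]. *)
Lemma run_decide w m f r : fwf 1 f -> 0 < w -> r 0 < 2 ^ w ->
  run w (decide f) (cost (r 0) f + 2) (Config 0 r m) =
  Some (nat_of_bool (sem w m 1 f r)).
Proof.
move=> wf w0 r0.
have [Pf] := code_at_cat (code_at_self (decide f)).
rewrite size_fcode => -[P1 [P2 [P3 [P4 _]]]].
have [t [R [le_t S1 _]]] :=
  fcode_run m Pf (R := r) (fun _ _ => erefl) wf isT r0.
pose l := if sem w m 1 f r then fsize f else (fsize f).+2.
have Pc : onth (decide f) l = Some (Const 1 (sem w m 1 f r)).
  by rewrite /l; case: (sem w m 1 f r).
have Ph : onth (decide f) l.+1 = Some (Halt 1).
  by rewrite /l; case: (sem w m 1 f r).
have S2 := steps_trans S1 (steps1 w (Config l R m) Pc I).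
(* [cost] is only an upper bound for [t]; the unspent fuel is left over at [Halt]. *)
have -> : cost (r 0) f + 2 = t + 1 + (cost (r 0) f - t).+1 by lia.
rewrite S2 /run; cbn [pc exec set_reg].
rewrite Ph /= /update eqxx modn_small //.
by rewrite (leq_ltn_trans (leq_b1 _)) // -[1]/(2 ^ 0) ltn_exp2l.
Qed.

(** Three bit lengths make [2 ^ w] at least the cube of a power of two that exceeds [n]. With that
    power written [b.+1], the binomial expansion beats [2 * b ^ 2 + 2]. *)
Lemma word_size_bound k n : 3 <= k -> 2 * n ^ 2 + 2 < 2 ^ word_size k n.
Proof.
move=> k3; apply: leq_trans (_ : 2 ^ word_size 3 n <= _); last first.
  by rewrite leq_exp2l // leq_mul2r k3 orbT.
rewrite /word_size (mulnC 3) expnM.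
have : n < 2 ^ (trunc_log 2 n).+1 by apply: trunc_log_ltn.
have : 2 <= 2 ^ (trunc_log 2 n).+1 by rewrite -[leqLHS]/(2 ^ 1) leq_exp2l.
case: (2 ^ (trunc_log 2 n).+1) => // b b1 nb; rewrite !expnS !expn0 !muln1.
have nn : n * n <= b * b by rewrite leq_mul.
rewrite (_ : b.+1 * _ = b * (b * b) + 3 * (b * b) + 3 * b + 1); last ring.
lia.
Qed.

Lemma cost_field_form : big_O (fun n => cost n field_form + 2) (fun n => n ^ 2).
Proof.
(* The cost is a quadratic polynomial in [n]; for [n >= 1] its lower terms are absorbed by [n ^ 2],
   and 2000 bounds the sum of its coefficients. *)
exists 2000, 1 => n n1; have n_n2 : n <= n ^ 2 by nia.
rewrite /=; nia.
Qed.

Theorem theorem1p5 :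
  exists (P : program) (T : nat -> nat),
    big_O T (fun n => n ^ 2) /\
    exists k0 : nat, forall k : nat, k0 <= k ->
      forall (F : finType) (add mul : F -> F -> F),
        decides_field (word_size k #|F|) P (T #|F|) add mul.
Proof.
exists (decide field_form), (fun n => cost n field_form + 2).
split; first exact: cost_field_form.
exists 3 => k k3 F add mul.
have wP := word_size_bound #|F| k3.
pose r := update (fun=> 0) 0 #|F|; have r0 : r 0 = #|F| by [].
exists (sem (word_size k #|F|) (nth 0 (cayley add ++ cayley mul)) 1
            field_form r).
split; last exact: sem_field_form.
apply: (run_decide _ (r := r)) => //.
  by rewrite muln_gt0 (leq_trans _ k3).
by apply: leq_ltn_trans wP; rewrite r0; nia.
Qed.
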